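(* Let $\mathcal{X}=\{x_i\}_{i=1}^m$ be a frame for $\mathbb{R}^n$ with frame operator $S$. The following are equivalent. (1) $\{S^{-1}x_i\}_{i=1}^m$ is scalable with scaling $\{a_i\}_{i=1}^m$ for some non-negative constants $\{a_i\}_{i=1}^m$, i.e. $\{a_iS^{-1}x_i\}_{i=1}^m$ is a Parseval frame. (2) There are constants $\{a_i\}_{i=1}^m\subset\mathbb{R}$ such that the frame operator of $\{a_ix_i\}_{i=1}^m$ is $S^2$. (3) There are constants $\{a_i\}_{i=1}^m\subset\mathbb{R}$ such that the frame $\{a_iS^{-1/2}x_i\}_{i=1}^m$ has $S$ as its frame operator.
   Context: A sequence $\{x_i\}_{i=1}^m\subset\mathbb{R}^n$ is a frame for $\mathbb{R}^n$ if there are $0<A\le B<\infty$ with $A\|x\|^2\le\sum_{i=1}^m|\langle x,x_i\rangle|^2\le B\|x\|^2$ for all $x\in\mathbb{R}^n$; it is a Parseval frame if one can take $A=B=1$. The frame operator of $\{x_i\}_{i=1}^m$ is $x\mapsto\sum_{i=1}^m\langle x,x_i\rangle x_i$ on $\mathbb{R}^n$; for a frame it is positive, self-adjoint and invertible. ''Scalable with scaling $\{a_i\}$'' means that $a_i\ge0$ and multiplying the $i$-th vector by $a_i$ for each $i$ yields a Parseval frame. The frame $\{S^{-1}x_i\}_{i=1}^m$ is the canonical dual frame of $\mathcal{X}$. *)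

(* Defs.v *)
From HB Require Import structures.
From mathcomp Require Import all_boot all_order all_algebra.
From mathcomp Require Import boolp classical_sets reals.

Set Implicit Arguments.
Unset Strict Implicit.
Unset Printing Implicit Defensive.

Import Order.TTheory GRing.Theory Num.Theory.
Local Open Scope ring_scope.

(* The Euclidean structure of R^n = 'rV[R]_n. The library's norm on 'rV[R]_n
   is the sup norm, and its dot product [dotmx] needs an algebraically closed
   field, so neither is usable here. *)
Definition dot (R : realType) (n : nat) (u v : 'rV[R]_n) : R :=
  \sum_(j < n) u 0 j * v 0 j.

Definition enorm (R : realType) (n : nat) (u : 'rV[R]_n) : R :=
  Num.sqrt (dot u u).

Definition frame_bounds (R : realType) (n m : nat) (A B : R)
    (x : 'I_m -> 'rV[R]_n) : Prop :=
  forall v : 'rV[R]_n,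
    A * enorm v ^+ 2 <= \sum_(i < m) `|dot v (x i)| ^+ 2 <= B * enorm v ^+ 2.

Definition is_frame (R : realType) (n m : nat) (x : 'I_m -> 'rV[R]_n) : Prop :=
  exists A B : R, [/\ 0 < A, A <= B & frame_bounds A B x].

Definition is_parseval (R : realType) (n m : nat)
    (x : 'I_m -> 'rV[R]_n) : Prop := frame_bounds 1 1 x.

Definition scale (R : realType) (n m : nat) (a : 'I_m -> R)
    (x : 'I_m -> 'rV[R]_n) : 'I_m -> 'rV[R]_n := fun i => a i *: x i.

Definition scalable_with (R : realType) (n m : nat) (x : 'I_m -> 'rV[R]_n)
    (a : 'I_m -> R) : Prop :=
  (forall i, 0 <= a i) /\ is_parseval (scale a x).

Definition frame_map (R : realType) (n m : nat) (x : 'I_m -> 'rV[R]_n)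
    (v : 'rV[R]_n) : 'rV[R]_n := \sum_(i < m) dot v (x i) *: x i.

Fact frame_map_is_linear (R : realType) (n m : nat) (x : 'I_m -> 'rV[R]_n) :
  linear (frame_map x).
Proof.
move=> c u v; rewrite /frame_map scaler_sumr -big_split /=.
apply: eq_bigr => i _; rewrite scalerA -scalerDl; congr (_ *: _).
rewrite /dot mulr_sumr -big_split /=.
by apply: eq_bigr => j _; rewrite !mxE mulrDl mulrA.
Qed.

HB.instance Definition _ (R : realType) (n m : nat) (x : 'I_m -> 'rV[R]_n) :=
  GRing.isLinear.Build R 'rV[R]_n 'rV[R]_n *:%R (frame_map x)
    (@frame_map_is_linear R n m x).

Definition frame_operator (R : realType) (n m : nat) (x : 'I_m -> 'rV[R]_n) :
  'End('rV[R]_n) := linfun (frame_map x).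

Fact frame_operatorE (R : realType) (n m : nat) (x : 'I_m -> 'rV[R]_n)
    (v : 'rV[R]_n) :
  frame_operator x v = \sum_(i < m) dot v (x i) *: x i.
Proof. by rewrite lfunE. Qed.

Definition self_adjoint (R : realType) (n : nat) (T : 'End('rV[R]_n)) : Prop :=
  forall u v : 'rV[R]_n, dot (T u) v = dot u (T v).

Definition positive_op (R : realType) (n : nat) (T : 'End('rV[R]_n)) : Prop :=
  forall v : 'rV[R]_n, 0 <= dot (T v) v.

(* The positive self-adjoint square root of a positive self-adjoint operator
   exists and is unique; [op_sqrt T] is that root, and 0 when T has none. *)
Definition op_sqrt (R : realType) (n : nat) (T : 'End('rV[R]_n)) :
  'End('rV[R]_n) :=
  xget 0 [set Q : 'End('rV[R]_n) |
    [/\ self_adjoint Q, positive_op Q & (Q \o Q)%VF = T]]%classic.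

(* Main.v *)
(* Writing S for the frame operator of x and F_a for that of (a_i x_i), a
   self-adjoint T turns (a_i T x_i) into a family with frame operator T F_a T.
   Being Parseval means having frame operator 1, so (1) reads S^-1 F_a S^-1 = 1,
   which is (2); signs of the a_i are irrelevant since only a_i^2 enters F_a.
   With Q = S^-1/2, which commutes with S, (3) reads Q F_a Q = S, which is (2)
   again.
   The root Q exists because a symmetric real matrix M is diagonalizable with
   real spectrum: if p interpolates the fourth root on the spectrum, then
   p(M)^4 = M, and p(M)^2 is a square root of M that is positive, being the
   square of a symmetric matrix. *)
Require Import Defs.
From mathcomp Require Import all_boot all_order all_algebra.
From mathcomp Require Import boolp classical_sets reals.
From mathcomp Require Import complex lra.

Set Implicit Arguments.
Unset Strict Implicit.
Unset Printing Implicit Defensive.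

Import Order.TTheory GRing.Theory Num.Theory.
Local Open Scope ring_scope.

(** Over [R[i]] the matrix becomes Hermitian, hence unitarily diagonalizable with a real diagonal;
    [s] lists that diagonal. Both conclusions then descend to [R], so no diagonalization over [R]
    has to be built. *)
Lemma symmetric_annihilator (R : rcfType) n (M : 'M[R]_n.+1) : M^T = M ->
  exists2 s : seq R, all (eigenvalue M) s
    & forall p : {poly R}, all (root p) s -> horner_mx M p = 0.
Proof.
move=> symM; pose f := real_complex R; pose A := map_mx f M.
have hermA : A \is hermitianmx _ false Num.conj.
  apply/is_hermitianmxP; rewrite expr0 scale1r.
  apply/matrixP => i j; rewrite !mxE conj_Creal.
    by rewrite -[in LHS]symM mxE.
  by apply/complex_realP; exists (M j i).
have /hermitian_normalmx/orthomx_spectralP := hermA.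
have := hermitian_spectral_diag_real hermA.
have := spectral_unit A.
move: (spectralmx A) (spectral_diag A) => P d uP /mxOverP realD defA.
have dE j : f (complex.Re (d 0 j)) = d 0 j by rewrite /f RRe_real.
exists [seq complex.Re (d 0 j) | j <- enum 'I_n.+1].
  apply/allP => _ /mapP[j _ ->].
  rewrite -(eigenvalue_map f) -[map_mx _ _]/A [X in eigenvalue _ X]dE.
  (* From A = P^-1 D P one gets P A = D P, so row j of P is a left eigenvector for d_j; it is
     nonzero because P is invertible. *)
  apply/eigenvalueP; exists (row j P).
    rewrite defA !mulmxA -row_mul mulmxV // row1.
    by rewrite -rowE row_diag_mx -scalemxAl -rowE.
  apply: contraTneq uP => P0; apply/negP => uP.
  have /rowP/(_ j)/eqP := congr1 (row j) (mulmxV uP).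
  by rewrite row_mul P0 mul0mx !mxE eqxx eq_sym oner_eq0.
(* The embedding into [R[i]] is injective, and there p(A) = P^-1 p(D) P with p(D) = 0. *)
move=> p rp; apply: (map_mx_inj (f := f)).
rewrite map_horner_mx -/A defA -{2}[P]invmxK horner_mx_uconj ?unitmx_inv //.
rewrite horner_mx_diag map_mx0 [X in diag_mx X](_ : _ = 0).
  by rewrite linear0 mulmx0 mul0mx.
apply/rowP => j; rewrite !mxE -dE horner_map.
have /(allP rp)/rootP -> := map_f (fun j => complex.Re (d 0 j)) (mem_enum _ j).
by rewrite rmorph0.
Qed.

(** Newton's scheme: a new node r is handled by adding a multiple of the polynomial [q] that
    vanishes at the earlier nodes. A repeated node is skipped, since there q(r) = 0. *)
Lemma interpolation (F : fieldType) (g : F -> F) (s : seq F) :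
  exists p : {poly F}, {in s, forall r, p.[r] = g r}.
Proof.
elim: s => [|r s [p ps]]; first by exists 0.
have [rs|rs] := boolP (r \in s).
  by exists p => t; rewrite inE => /predU1P[->|]; apply: ps.
pose q := \prod_(t <- s) ('X - t%:P).
have qr0 : q.[r] != 0 by rewrite -[_ == 0]/(root q r) root_prod_XsubC.
exists (p + ((g r - p.[r]) / q.[r]) *: q) => t; rewrite inE !hornerE.
have [-> _|_ ts] := eqVneq t r; first by rewrite divfK // addrC subrK.
have /rootP -> : root q t by rewrite root_prod_XsubC.
by rewrite mulr0 addr0 ps.
Qed.

Lemma trmx_horner_mx (R : comNzRingType) n (M : 'M[R]_n.+1) p :
  M^T = M -> (horner_mx M p)^T = horner_mx M p.
Proof.
move=> symM; elim/poly_ind: p => [|p c IH]; first by rewrite !rmorph0 trmx0.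
rewrite rmorphD rmorphM /= horner_mx_X horner_mx_C linearD /= tr_scalar_mx.
rewrite -[_ * M]/(_ *m M) trmx_mul IH symM; congr (_ + _).
(* Transposition reverses the product p(M) M, and M commutes with p(M). *)
exact/comm_mx_horner.
Qed.

Lemma dotE (R : realType) n (u v : 'rV[R]_n) : dot u v = (u *m v^T) 0 0.
Proof. by rewrite !mxE; apply: eq_bigr => j _; rewrite mxE. Qed.

Lemma dot_mulmx (R : realType) n (M : 'M[R]_n) u v :
  dot (u *m M) v = dot u (v *m M^T).
Proof. by rewrite !dotE trmx_mul trmxK mulmxA. Qed.

Lemma dotC (R : realType) n (u v : 'rV[R]_n) : dot u v = dot v u.
Proof. by apply: eq_bigr => j _; rewrite mulrC. Qed.

Lemma dotDl (R : realType) n (u v w : 'rV[R]_n) :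
  dot (u + v) w = dot u w + dot v w.
Proof. by rewrite !dotE mulmxDl mxE. Qed.

Lemma dotDr (R : realType) n (u v w : 'rV[R]_n) :
  dot u (v + w) = dot u v + dot u w.
Proof. by rewrite dotC dotDl !(dotC u). Qed.

Lemma dotZl (R : realType) n c (u v : 'rV[R]_n) : dot (c *: u) v = c * dot u v.
Proof. by rewrite !dotE -scalemxAl mxE. Qed.

Lemma dotZr (R : realType) n c (u v : 'rV[R]_n) : dot u (c *: v) = c * dot u v.
Proof. by rewrite dotC dotZl dotC. Qed.

Lemma dot_ge0 (R : realType) n (u : 'rV[R]_n) : 0 <= dot u u.
Proof. by apply: sumr_ge0 => j _; rewrite -expr2 sqr_ge0. Qed.

Lemma dot_eq0 (R : realType) n (u : 'rV[R]_n) : (dot u u == 0) = (u == 0).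
Proof.
apply/eqP/eqP => [|->]; last by rewrite dotE mul0mx mxE.
move/eqP; rewrite psumr_eq0 => [/allP u0|j _]; last by rewrite -expr2 sqr_ge0.
apply/rowP => j; rewrite mxE; apply/eqP.
by have := u0 j (mem_index_enum j); rewrite mulf_eq0 orbb.
Qed.

Lemma dot_inj (R : realType) n (u v : 'rV[R]_n) :
  (forall w, dot u w = dot v w) -> u = v.
Proof.
move=> uv; apply/eqP; rewrite -subr_eq0 -dot_eq0 -scaleN1r dotDl dotZl mulN1r.
by rewrite uv subrr.
Qed.

Lemma sqr_enorm (R : realType) n (u : 'rV[R]_n) : enorm u ^+ 2 = dot u u.
Proof. exact/sqr_sqrtr/dot_ge0. Qed.

Lemma symmetric_psd_root4 (R : realType) n (M : 'M[R]_n) :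
  M^T = M -> (forall v : 'rV_n, 0 <= dot (v *m M) v) ->
  exists2 N : 'M[R]_n, N^T = N & N *m N *m (N *m N) = M.
Proof.
(* Evaluating polynomials at a matrix requires positive size, so dimension 0 is treated apart. *)
case: n => [|n] in M *; first by exists 0; apply/matrixP => -[].
move=> symM psdM; have [s eig_s annM] := symmetric_annihilator symM.
have [p ps] := interpolation (fun r => Num.sqrt (Num.sqrt r)) s.
exists (horner_mx M p); first exact: trmx_horner_mx.
have -> (N : 'M[R]_n.+1) : N *m N *m (N *m N) = N ^+ 4 by rewrite (exprD N 2 2).
(* The equation p(M)^4 = M says that p^4 - X annihilates M, so it suffices that p(r)^4 = r for r in
   [s]. *)
apply/eqP; rewrite -subr_eq0 -{2}(horner_mx_X M) -rmorphXn -rmorphB /=.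
apply/eqP/annM/allP => r rs; rewrite /root !hornerE ps // (exprM _ 2 2).
rewrite !sqr_sqrtr ?sqrtr_ge0 ?subrr //.
(* For an eigenvector v, r <v, v> = <v M, v> >= 0 forces r >= 0, so the nested square roots are
   genuine. *)
have /eigenvalueP[v vM v0] := allP eig_s r rs.
have := psdM v; rewrite vM dotZl pmulr_lge0 // lt0r dot_eq0 v0.
exact: dot_ge0.
Qed.

(** [xget] returns a member of any nonempty set, so exhibiting one root suffices. *)
Lemma op_sqrtP (R : realType) n (T : 'End('rV[R]_n)) :
  self_adjoint T -> positive_op T ->
  [/\ self_adjoint (op_sqrt T), positive_op (op_sqrt T)
    & (op_sqrt T \o op_sqrt T)%VF = T].
Proof.
move=> saT posT; rewrite /op_sqrt; set P := [set _ | _]%classic.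
suff : exists Q, P Q by move/(xgetPex 0).
pose M := lin1_mx T; have TM u : T u = u *m M by rewrite mul_rV_lin1.
have symM : M^T = M.
  (* Self-adjointness on pairs of basis vectors is symmetry of the matrix. *)
  apply/matrixP => i j; rewrite mxE.
  have := saT (delta_mx 0 j) (delta_mx 0 i).
  by rewrite !TM [RHS]dotC !dotE !trmx_delta -!colE -!rowE !mxE.
have psdM (v : 'rV_n) : 0 <= dot (v *m M) v by rewrite -TM.
have [N symN defM] := symmetric_psd_root4 symM psdM.
exists (linfun (mulmxr (N *m N))); split.
- by move=> u v; rewrite !lfunE /= dot_mulmx trmx_mul symN.
- by move=> v; rewrite lfunE /= mulmxA dot_mulmx symN dot_ge0.
- by apply/lfunP => u; rewrite comp_lfunE !lfunE /= -mulmxA defM TM.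
Qed.

Lemma dot_frame_operator (R : realType) n m (x : 'I_m -> 'rV[R]_n) u v :
  dot (frame_operator x u) v = \sum_(i < m) dot u (x i) * dot v (x i).
Proof.
rewrite frame_operatorE dotE mulmx_suml summxE; apply: eq_bigr => i _.
by rewrite -dotE dotZl (dotC v).
Qed.

Lemma frame_operator_sa (R : realType) n m (x : 'I_m -> 'rV[R]_n) :
  self_adjoint (frame_operator x).
Proof.
move=> u v; rewrite (dotC u) !dot_frame_operator.
by apply: eq_bigr => i _; rewrite mulrC.
Qed.

(** Turns frame bounds into bounds on the quadratic form of the frame operator. *)
Lemma sum_sqr_dot (R : realType) n m (x : 'I_m -> 'rV[R]_n) v :
  \sum_(i < m) `|dot v (x i)| ^+ 2 = dot (frame_operator x v) v.
Proof.
rewrite dot_frame_operator; apply: eq_bigr => i _.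
by rewrite real_normK ?num_real // expr2.
Qed.

Lemma frame_operator_pos (R : realType) n m (x : 'I_m -> 'rV[R]_n) :
  positive_op (frame_operator x).
Proof. by move=> v; rewrite -sum_sqr_dot; apply: sumr_ge0 => i _; apply: exprn_ge0. Qed.

Lemma eq_frame_operator_is_frame (R : realType) n m
    (x y : 'I_m -> 'rV[R]_n) :
  frame_operator x = frame_operator y -> is_frame x -> is_frame y.
Proof.
move=> xy [A [B [A0 AB xAB]]]; exists A, B; split=> // v.
by rewrite sum_sqr_dot -xy -sum_sqr_dot.
Qed.

(** If F w = 0, the lower bound gives A |w|^2 <= <F w, w> = 0 with A > 0. A trivial kernel makes
    [S^-1] a two-sided inverse. *)
Lemma lker_frame_operator (R : realType) n m (x : 'I_m -> 'rV[R]_n) :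
  is_frame x -> lker (frame_operator x) == 0%VS.
Proof.
move=> [A [B [A0 _ xAB]]]; apply/lker0P => u v /eqP.
rewrite -subr_eq0 -raddfB /= => /eqP Fuv; apply/eqP; rewrite -subr_eq0.
have /andP[+ _] := xAB (u - v).
rewrite sum_sqr_dot Fuv sqr_enorm [dot 0 _]dotE mul0mx mxE pmulr_rle0 // => uv.
by rewrite -dot_eq0 eq_le uv dot_ge0.
Qed.

Lemma is_parsevalE (R : realType) n m (x : 'I_m -> 'rV[R]_n) :
  is_parseval x <-> frame_operator x = \1%VF.
Proof.
split=> [xP | Fx v]; last by rewrite sum_sqr_dot Fx id_lfunE sqr_enorm !mul1r lexx.
set F := frame_operator x.
have Fq v : dot (F v) v = dot v v.
  have := xP v; rewrite !mul1r andbC -eq_le sum_sqr_dot sqr_enorm.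
  by move/eqP.
apply/lfunP => u; rewrite id_lfunE; apply: dot_inj => w.
(* Polarization: self-adjointness makes the two cross terms equal, giving <F u, w> = <u, w>. *)
have := Fq (u + w); rewrite linearD /= !(dotDl, dotDr) !Fq.
by rewrite (frame_operator_sa x w u) (dotC w u) (dotC w (F u)); lra.
Qed.

(** Self-adjointness moves one T onto the argument of the coefficients; linearity pulls the other
    out of the sum. *)
Lemma frame_operator_scale_lfun (R : realType) n m (x : 'I_m -> 'rV[R]_n)
    (a : 'I_m -> R) (T : 'End('rV[R]_n)) :
  self_adjoint T ->
  frame_operator (scale a (fun i => T (x i)))
    = (T \o (frame_operator (scale a x) \o T))%VF.
Proof.
move=> saT; apply/lfunP => v; rewrite !comp_lfunE !frame_operatorE linear_sum.
by apply: eq_bigr => i _; rewrite /scale !linearZ /= !dotZr saT !scalerA mulrC.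
Qed.

Lemma frame_operator_scale_norm (R : realType) n m (x : 'I_m -> 'rV[R]_n)
    (a : 'I_m -> R) :
  frame_operator (scale (fun i => `|a i|) x) = frame_operator (scale a x).
Proof.
apply/lfunP => v; rewrite !frame_operatorE; apply: eq_bigr => i _.
rewrite /scale !dotZr !scalerA; congr (_ *: _).
by rewrite mulrAC [RHS]mulrAC -!expr2 real_normK ?num_real.
Qed.

Lemma inv_lfun_sa (R : realType) n (T : 'End('rV[R]_n)) :
  lker T == 0%VS -> self_adjoint T -> self_adjoint T^-1%VF.
Proof.
by move=> kT saT u v; rewrite -{1}(lker0_lfunVK kT v) -saT lker0_lfunVK.
Qed.

(** With w = T^-1 v, <T^-1 v, v> = <w, T w>. *)
Lemma inv_lfun_pos (R : realType) n (T : 'End('rV[R]_n)) :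
  lker T == 0%VS -> positive_op T -> positive_op T^-1%VF.
Proof. by move=> kT posT v; rewrite -{2}(lker0_lfunVK kT v) dotC. Qed.

Theorem theorem5p7 (R : realType) (n m : nat) (x : 'I_m -> 'rV[R]_n)
    (hx : is_frame x) :
  let S := frame_operator x in
  ((exists a : 'I_m -> R, scalable_with (fun i => (S^-1)%VF (x i)) a)
   <->
   (exists a : 'I_m -> R, frame_operator (scale a x) = (S \o S)%VF))
  /\
  ((exists a : 'I_m -> R, frame_operator (scale a x) = (S \o S)%VF)
   <->
   (exists a : 'I_m -> R,
      let y := scale a (fun i => op_sqrt (S^-1)%VF (x i)) in
      is_frame y /\ frame_operator y = S)).
Proof.
move=> S; have kS : lker S == 0%VS := lker_frame_operator hx.
have saV : self_adjoint S^-1%VF := inv_lfun_sa kS (@frame_operator_sa _ _ _ x).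
have posV : positive_op S^-1%VF := inv_lfun_pos kS (@frame_operator_pos _ _ _ x).
have [saQ _] := op_sqrtP saV posV; move: (op_sqrt _) saQ => Q saQ QQ.
(* Since Q^2 = S^-1, Q S = S (Q Q) Q S = S Q (Q Q S) = S Q. *)
have QS : (Q \o S = S \o Q)%VF.
  rewrite -[LHS](lker0_compVKf kS) -QQ -!comp_lfunA.
  by rewrite (comp_lfunA Q Q S) QQ lker0_compVf // comp_lfun1r.
split; split=> -[a].
- move=> [_ /is_parsevalE]; rewrite frame_operator_scale_lfun // => VFV.
  (* The same constants serve: compose S^-1 F S^-1 = 1 with S on both sides. *)
  exists a; rewrite -(lker0_compVKf kS (frame_operator _)).
  rewrite -(lker0_compfVK kS (_ \o frame_operator _)%VF).
  by rewrite -(comp_lfunA S^-1%VF) VFV comp_lfun1l.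
- move=> FSS; exists (fun i => `|a i|); split=> [i //|].
  apply/is_parsevalE; rewrite frame_operator_scale_lfun //.
  by rewrite frame_operator_scale_norm FSS -comp_lfunA lker0_compKf // lker0_compfV.
- move=> FSS; exists a => y.
  (* Commuting Q past S gives Q S S Q = Q Q S S = S^-1 S S = S. *)
  have Fy : frame_operator y = S.
    rewrite frame_operator_scale_lfun // FSS -comp_lfunA -QS (comp_lfunA S Q) -QS.
    by rewrite -comp_lfunA (comp_lfunA Q Q) QQ lker0_compKf.
  (* [y] inherits the frame bounds of [x], having the same frame operator. *)
  by split=> //; apply: eq_frame_operator_is_frame hx.
- move=> /= [_]; rewrite frame_operator_scale_lfun // => QFQ.
  exists a; set F := frame_operator _ in QFQ *.
  (* S Q and Q S are inverse to Q on the left and on the right, so F = (S Q)(Q F Q)(Q S) = S Q S Q S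
     = S S. *)
  have -> : F = (S \o Q \o (Q \o (F \o Q)) \o (Q \o S))%VF.
    rewrite -!comp_lfunA (comp_lfunA Q Q S) QQ lker0_compVf // comp_lfun1r.
    by rewrite (comp_lfunA Q Q F) QQ lker0_compVKf.
  rewrite QFQ -!comp_lfunA (comp_lfunA S Q S) -QS -comp_lfunA.
  by rewrite (comp_lfunA Q Q) QQ lker0_compKf.
Qed.
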